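(* Let $K\ge 1$ and $0\le L<U\le K$ be integers. Define $\bar w_L^*=1/2$ if $L+U=K$, and otherwise $$\bar w_L^*=\frac{(U-L)(L+U-K)K-2U(K-U)+\sqrt{(U-L)^2(L+U-K)^2K^2+4L(K-L)U(K-U)}}{2(U-L)(L+U-K)(K+1)}.$$ If $$(K-2L)(2U-K)<K,$$ then the invariant design on the orbits $\mathcal{O}_L$ and $\mathcal{O}_U$ with weights $\bar w_L^*$ and $\bar w_U^*=1-\bar w_L^*$, i.e. the design $\bar w_L^*\,\bar\xi_L+(1-\bar w_L^* )\,\bar\xi_U$, is $D$-optimal on $\mathcal{X}$.
   Context: Let $K\ge 1$ and $0\le L<U\le K$ be integers. For $\bm{x}=(x_1,\dots,x_K)^\top\in\{-1,+1\}^K$ let $d(\bm{x})=(K+\sum_{j=1}^K x_j)/2$ be the number of entries equal to $+1$. The design region is $\mathcal{X}=\{\bm{x}\in\{-1,+1\}^K : L\le d(\bm{x})\le U\}$. The regression function is $\bm{f}(\bm{x})=(1,x_1,\dots,x_K)^\top\in\mathbb{R}^{K+1}$. A design $\xi$ on $\mathcal{X}$ is a probability weight function on the finite set $\mathcal{X}$ ($\xi(\bm{x})\ge 0$ real, $\sum_{\bm{x}\in\mathcal{X}}\xi(\bm{x})=1$). Its information matrix is $\mathbf{M}(\xi)=\sum_{\bm{x}\in\mathcal{X}}\xi(\bm{x})\bm{f}(\bm{x})\bm{f}(\bm{x})^\top$. A design $\xi^*$ on $\mathcal{X}$ is $D$-optimal if $\det\mathbf{M}(\xi^* )\ge\det\mathbf{M}(\xi)$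 for all designs $\xi$ on $\mathcal{X}$. For $k\in\{L,\dots,U\}$ the orbit is $\mathcal{O}_k=\{\bm{x}\in\mathcal{X}: d(\bm{x})=k\}$, and $\bar\xi_k$ denotes the uniform design on $\mathcal{O}_k$, with weight $1/\binom{K}{k}$ at each point of $\mathcal{O}_k$. An invariant design is a design of the form $\bar\xi=\sum_{k=L}^U\bar w_k\bar\xi_k$ with orbit weights $\bar w_k\ge 0$, $\sum_{k=L}^U\bar w_k=1$ (equivalently, a design invariant under permutations of the $K$ coordinates). *)

(* Defs.v *)
From mathcomp Require Import all_boot all_order all_algebra.
From mathcomp Require Import reals.

Set Implicit Arguments.
Unset Strict Implicit.
Unset Printing Implicit Defensive.

Import Order.TTheory GRing.Theory Num.Theory.
Local Open Scope ring_scope.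

(* {-1, +1}^K, with [true] encoding the entry +1 and [false] the entry -1;
   the real value of an entry is given by [sgval]. *)
Definition signs (K : nat) : finType := {ffun 'I_K -> bool}.

Definition sgval (R : realType) (b : bool) : R := if b then 1 else - 1.

Definition depth (K : nat) (x : signs K) : nat := #|[set j : 'I_K | x j]|.

Lemma depthE (R : realType) (K : nat) (x : signs K) :
  (depth x)%:R = (K%:R + \sum_(j < K) sgval R (x j)) / 2 :> R.
Proof.
have -> : \sum_(j < K) sgval R (x j)
    = \sum_(j < K) ((x j)%:R *+ 2 - 1 : R).
  by apply: eq_bigr => j _; rewrite /sgval; case: (x j);
     rewrite ?mulr2n ?addrK ?addr0 ?sub0r.
rewrite sumrB sumr_const card_ord addrC subrK sumrMnl -[_ *+ 2]mulr_natr.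
rewrite mulfK ?pnatr_eq0 // /depth -sum1_card natr_sum big_mkcond /=.
by apply: eq_bigr => j _; rewrite inE; case: (x j).
Qed.

Definition region (K L U : nat) : finType :=
  {x : signs K | (L <= depth x <= U)%N}.

Section Designs.
Variables (R : realType) (K L U : nat).

Definition regression (x : signs K) : 'cV[R]_(1 + K) :=
  col_mx 1%:M (\col_(j < K) sgval R (x j)).

Definition is_design (xi : region K L U -> R) : Prop :=
  (forall x, 0 <= xi x) /\ \sum_x xi x = 1.

Definition info_matrix (xi : region K L U -> R) : 'M[R]_(1 + K) :=
  \sum_x xi x *: (regression (val x) *m (regression (val x))^T).

Definition D_optimal (xi : region K L U -> R) : Prop :=
  is_design xi /\
  forall xi' : region K L U -> R, is_design xi' ->
    \det (info_matrix xi') <= \det (info_matrix xi).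

Definition orbit_design (k : nat) (x : region K L U) : R :=
  if depth (val x) == k then 'C(K, k)%:R^-1 else 0.

Definition invariant_design (w : nat -> R) (x : region K L U) : R :=
  \sum_(L <= k < U.+1) w k * orbit_design k x.

End Designs.

Definition wL_opt (R : realType) (K L U : nat) : R :=
  let k : R := K%:R in let l : R := L%:R in let u : R := U%:R in
  if (L + U == K)%N then 1 / 2
  else ((u - l) * (l + u - k) * k - 2 * u * (k - u)
        + Num.sqrt ((u - l) ^+ 2 * (l + u - k) ^+ 2 * k ^+ 2
                    + 4 * l * (k - l) * u * (k - u)))
       / (2 * (u - l) * (l + u - k) * (k + 1)).

Definition opt_weight (R : realType) (K L U k : nat) : R :=
  if k == L then wL_opt R K L U
  else if k == U then 1 - wL_opt R K L U
  else 0.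

Lemma invariant_design_opt_weight (R : realType) (K L U : nat)
    (hLU : (L < U)%N) (x : region K L U) :
  invariant_design (opt_weight R K L U) x =
    wL_opt R K L U * orbit_design R L x
    + (1 - wL_opt R K L U) * orbit_design R U x.
Proof.
rewrite /invariant_design big_nat_recr 1?ltnW //= big_ltn //=.
rewrite /opt_weight eqxx (gtn_eqF hLU) eqxx.
rewrite [X in _ + X + _]big1_seq ?addr0 // => k /andP[_].
rewrite mem_index_iota => /andP[hk hkU].
by rewrite (gtn_eqF hk) (ltn_eqF hkU) mul0r.
Qed.

(* Main.v *)
Require Import Defs.
From mathcomp Require Import all_boot all_order all_algebra perm.
From mathcomp Require Import reals.
From mathcomp Require Import ring lra zify.

Set Implicit Arguments.
Unset Strict Implicit.
Unset Printing Implicit Defensive.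

Import Order.TTheory GRing.Theory Num.Theory.
Local Open Scope ring_scope.

(** The proof is an equivalence-theorem argument.  Let [M] be the information
matrix of the claimed design, [N] its inverse, and
[psi x = f(x)^T N f(x)] the associated variance function.  For any other design
[xi'] with information matrix [M'], the trace of [N M'] is the [xi']-average of
[psi], and [det (N M') <= (tr (N M') / n)^n] with [n = K + 1]
([det_mul_psd_le]: write [N = G^T G], then apply Hadamard's inequality and the
inequality between arithmetic and geometric means to [G M' G^T]).  Hence
[psi <= n] on the design region implies [det M' <= det M]
([det_info_le_of_variance_bound]).

For a design mixing two orbits, [M] only depends on the first two moments of
the coordinates, so it has an explicit inverse.  Writing [d] for the depth of
[x], [p] and [q = 1 - p] for the weights of the orbits [L] and [U], and
[nu = p L + q U], [W = p q (U - L)^2], [D = p L (K - L) + q U (K - U)],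
one finds
[psi x = 1 + (d - nu)^2 / W + (K - 1) d (K - d) / D].

The weight [wL_opt] is the root in [(0, 1)] of the quadratic equation [stationary]
([wL_opt_stationary]), which expresses that [psi] takes the same value on both
orbits; as the average of [psi] is [K + 1], this common value is [K + 1].
Therefore [psi - (K + 1) = (1 / W - (K - 1) / D) (d - L) (d - U)], and
it remains to see that this is a convex function of [d], that is,
[(K - 1) W <= D]; this is where the condition [(K - 2 L) (2 U - K) < K] enters
([stationary_convex]). *)

(** * Determinants of positive semidefinite matrices *)

Section PSD.
Variable R : rcfType.

(** The quadratic form [x^T A x]. *)
Definition qform n (A : 'M[R]_n) (x : 'cV[R]_n) : R := (x^T *m A *m x) 0 0.

(** Real positive semidefinite matrices; symmetry is part of the notion. *)
Definition psd n (A : 'M[R]_n) : Prop := A^T = A /\ forall x, 0 <= qform A x.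

Lemma qform_block n a (v : 'cV[R]_n) (B : 'M[R]_n) s (y : 'cV[R]_n) :
  qform (block_mx a%:M v^T v B : 'M_(1 + n)) (col_mx s%:M y)
  = a * s ^+ 2 + 2 * s * (v^T *m y) 0 0 + qform B y.
Proof.
rewrite /qform tr_col_mx mul_row_block mul_row_col tr_scalar_mx.
rewrite -scalar_mxM !mulmxDl !mul_scalar_mx !mul_mx_scalar.
have -> : y^T *m v = v^T *m y.
  by rewrite -[v in LHS]trmxK -trmx_mul; apply/matrixP=> i j; rewrite !ord1 !mxE.
rewrite -!scalemxAl !(scale_scalar_mx, mxE) eqxx mulr1n.
ring.
Qed.

(** One step of the LDL decomposition: [a] is the top left entry and [S] its Schur
complement.  A vanishing pivot [a] is allowed, since the rest of its row is then
zero; so [u] need not be specified in that case. *)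
Lemma psd_block_ldl n (A : 'M[R]_(1 + n)) : psd A ->
  exists a (u : 'cV[R]_n) (S : 'M[R]_n), [/\ 0 <= a, psd S
    & A = block_mx a%:M (a *: u^T) (a *: u) (S + a *: (u *m u^T))].
Proof.
move=> [symA posA].
pose a := A 0 0; pose v := dlsubmx A; pose B := drsubmx A.
have eqA : A = block_mx a%:M v^T v B.
  rewrite -[LHS]submxK; congr block_mx.
    by apply/matrixP=> i j; rewrite !ord1 !mxE eqxx !lshift0.
  by rewrite -{1}symA /v trmx_dlsub.
have symB : B^T = B by rewrite /B trmx_drsub symA.
have a_ge0 : 0 <= a.
  have := posA (col_mx 1%:M 0); rewrite eqA qform_block /qform trmx0 !mul0mx mulmx0.
  by rewrite mxE mulr0 !addr0 expr1n mulr1.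
pose u := a^-1 *: v.
have eqv : v = a *: u.
  have [a0|a0] := eqVneq a 0; last by rewrite scalerA divff // scale1r.
  rewrite a0 scale0r.
  have pos s : 0 <= 2 * s * (v^T *m v) 0 0 + qform B v.
    by have := posA (col_mx s%:M v); rewrite eqA qform_block a0 mul0r add0r.
  have vv0 : (v^T *m v) 0 0 = 0.
    (* Otherwise [2 s (v^T v) + v^T B v] equals [-1] for a suitable [s]. *)
    apply/eqP/negP => /negP vv0.
    have := pos (- (qform B v + 1) / (2 * (v^T *m v) 0 0)).
    have -> : 2 * (- (qform B v + 1) / (2 * (v^T *m v) 0 0)) * (v^T *m v) 0 0
       = - (qform B v + 1) by field.
    by lra.
  apply/colP=> i; rewrite [RHS]mxE; apply/eqP; rewrite -sqrf_eq0.
  move: vv0; rewrite mxE => /eqP; rewrite psumr_eq0 => [|j _]; last first.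
    by rewrite mxE -expr2 sqr_ge0.
  by move/allP/(_ i); rewrite mem_index_enum => /(_ isT); rewrite mxE -expr2.
move: u eqv => u eqv.
exists a, u, (B - a *: (u *m u^T)); split => //; last first.
  by rewrite subrK eqA eqv linearZ.
split.
  by rewrite linearB /= linearZ /= trmx_mul trmxK symB.
(* The form of [S] at [y] is that of [A] at the point over [y] where the latter is
   least, whose first coordinate is [- u^T y]. *)
move=> y; have := posA (col_mx (- (u^T *m y) 0 0)%:M y).
rewrite eqA qform_block {1}eqv linearZ /= -scalemxAl.
set t := (u^T *m y) 0 0. have -> : (a *: (u^T *m y)) 0 0 = a * t by rewrite mxE.
have -> : qform (B - a *: (u *m u^T)) y = qform B y - a * (y^T *m (u *m u^T) *m y) 0 0.
  by rewrite /qform mulmxBr mulmxBl -scalemxAr -scalemxAl !mxE.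
have -> : (y^T *m (u *m u^T) *m y) 0 0 = t * t.
  rewrite mulmxA -mulmxA mxE big_ord1.
  by rewrite -[y^T *m u]trmxK trmx_mul trmxK [_^T _ _]mxE.
by move=> h; apply: (le_trans h); rewrite le_eqVlt; apply/orP; left; apply/eqP; ring.
Qed.

Lemma det_ldl n a (u : 'cV[R]_n) (S : 'M[R]_n) :
  \det (block_mx a%:M (a *: u^T) (a *: u) (S + a *: (u *m u^T)) : 'M_(1 + n))
  = a * \det S.
Proof.
have -> : block_mx a%:M (a *: u^T) (a *: u) (S + a *: (u *m u^T))
  = block_mx 1%:M 0 u S *m block_mx a%:M (a *: u^T) 0 1%:M :> 'M_(1 + n).
  rewrite mulmx_block !mul1mx !mul0mx !mulmx0 mulmx1 !addr0 mul_mx_scalar.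
  by rewrite -scalemxAr [S + _]addrC.
by rewrite det_mulmx det_lblock det_ublock det1 det_scalar1 det1 mul1r mulr1 mulrC.
Qed.

(** Hadamard's inequality. *)
Lemma hadamard_psd n (A : 'M[R]_n) : psd A ->
  (forall i, 0 <= A i i) /\ 0 <= \det A <= \prod_i A i i.
Proof.
elim: n A => [|n IHn] A.
  by rewrite det_mx00 big_ord0 ler01 lexx; split=> [[]|].
move: A; rewrite -[n.+1]/(1 + n)%N => A.
move=> /psd_block_ldl[a [u [S [a0 /IHn[S0 /andP[dS0 dS1]] ->]]]].
set T := S + _.
have Tge i : S i i <= T i i.
  rewrite !mxE big_ord1 mxE -expr2 lerDl.
  by rewrite mulr_ge0 ?sqr_ge0.
split.
  move=> i; case: (split_ordP i) => j ->.
    by rewrite block_mxEul !ord1 mxE eqxx.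
  by rewrite block_mxEdr (le_trans (S0 j)).
rewrite det_ldl mulr_ge0 //= -/T big_split_ord big_ord1 /=.
rewrite block_mxEul mxE eqxx ler_wpM2l // (le_trans dS1) // ler_prod // => i _.
by rewrite block_mxEdr S0 Tge.
Qed.

Lemma psd_gram n (A : 'M[R]_n) : psd A -> exists G : 'M[R]_n, A = G^T *m G.
Proof.
elim: n A => [|n IHn] A; first by exists 1%:M; apply/matrixP=> [[]].
move: A; rewrite -[n.+1]/(1 + n)%N => A.
move=> /psd_block_ldl[a [u [S [a0 /IHn[H ->] ->]]]].
exists (block_mx (Num.sqrt a)%:M (Num.sqrt a *: u^T) 0 H).
rewrite tr_block_mx mulmx_block.
have -> : (Num.sqrt a *: u^T)^T = Num.sqrt a *: u by rewrite linearZ /= trmxK.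
rewrite tr_scalar_mx !trmx0 !mul0mx !mulmx0 -scalar_mxM mul_scalar_mx.
rewrite mul_mx_scalar -scalemxAl -scalemxAr !scalerA.
by rewrite -expr2 sqr_sqrtr // !addr0 [H^T *m H + _]addrC.
Qed.

(** The geometric mean of the eigenvalues of [N M] is at most their arithmetic
mean. *)
Lemma det_mul_psd_le n (N M : 'M[R]_n) : psd N -> psd M ->
  0 <= \det N * \det M <= (\tr (N *m M) / n%:R) ^+ n.
Proof.
move=> /psd_gram[G ->] [symM posM].
have /hadamard_psd[d0 /andP[h0 h1]] : psd (G *m M *m G^T).
  split; first by rewrite !trmx_mul trmxK symM mulmxA.
  by move=> x; have := posM (G^T *m x); rewrite /qform trmx_mul trmxK !mulmxA.
have eqd : \det (G^T *m G) * \det M = \det (G *m M *m G^T).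
  by rewrite !det_mulmx; ring.
rewrite eqd h0 (le_trans h1) // -(mulmxA G^T) (mxtrace_mulC G^T).
have := @leif_AGM R 'I_n 'I_n (fun i => (G *m M *m G^T) i i) (fun i _ => d0 i).
rewrite card_ord => -[+ _] => /le_trans; exact.
Qed.
End PSD.

(** * A sufficient condition for D-optimality *)

Section Sufficiency.
Variables (R : rcfType) (T : finType) (n : nat).
Implicit Types (f : T -> 'cV[R]_n) (w : T -> R).

Lemma psd_sum_outer f w : (forall x, 0 <= w x) ->
  psd (\sum_x w x *: (f x *m (f x)^T)).
Proof.
move=> w0; split.
  rewrite raddf_sum /=; apply: eq_bigr => x _.
  by rewrite linearZ /= trmx_mul trmxK.
move=> y; rewrite /qform mulmx_sumr mulmx_suml summxE sumr_ge0 // => x _.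
rewrite -scalemxAr -scalemxAl mxE mulr_ge0 // (mulmxA y^T).
rewrite -(mulmxA (y^T *m f x)) mxE big_ord1.
by rewrite -{1}[f x]trmxK -trmx_mul mxE -expr2 sqr_ge0.
Qed.

Lemma tr_mul_sum_outer (N : 'M[R]_n) f w :
  \tr (N *m (\sum_x w x *: (f x *m (f x)^T))) = \sum_x w x * qform N (f x).
Proof.
rewrite mulmx_sumr raddf_sum /=; apply: eq_bigr => x _.
rewrite -scalemxAr mxtraceZ mulmxA mxtrace_mulC mulmxA.
by rewrite /qform /mxtrace big_ord1.
Qed.

(** The sufficiency half of the Kiefer-Wolfowitz equivalence theorem: [w0] is
D-optimal if its variance function is at most the number of parameters. *)
Lemma det_info_le_of_variance_bound f (w0 w : T -> R) (N : 'M[R]_n) :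
    (0 < n)%N ->
    (forall x, 0 <= w0 x) ->
    (forall x, 0 <= w x) -> \sum_x w x = 1 ->
    (\sum_x w0 x *: (f x *m (f x)^T)) *m N = 1%:M ->
    (forall x, qform N (f x) <= n%:R) ->
  \det (\sum_x w x *: (f x *m (f x)^T)) <= \det (\sum_x w0 x *: (f x *m (f x)^T)).
Proof.
move=> n0 w0_ge0 w_ge0 sumw eqN bound.
have [symM posM] := psd_sum_outer f w0_ge0.
have psdw := psd_sum_outer f w_ge0.
set M := \sum_x _ in eqN symM posM *; set M' := \sum_x _ in psdw *.
have symN : N^T = N.
  have eqN' : N^T *m M = 1%:M by rewrite -[M]symM -trmx_mul eqN trmx1.
  by rewrite -[LHS]mulmx1 -eqN mulmxA eqN' mul1mx.
(* [x^T N x = (N x)^T M (N x)], since [N] is the inverse of [M]. *)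
have psdN : psd N.
  split=> // x; have := posM (N *m x).
  by rewrite /qform trmx_mul symN -!mulmxA [M *m _]mulmxA eqN mul1mx.
have /andP[ge0 le1] := det_mul_psd_le psdN psdw.
have detN : \det M * \det N = 1 by rewrite -det_mulmx eqN det1.
have trle : \tr (N *m M') <= n%:R.
  have -> : n%:R = \sum_x w x * n%:R by rewrite -mulr_suml sumw mul1r.
  rewrite tr_mul_sum_outer.
  by apply: ler_sum => x _; rewrite ler_wpM2l.
have trge : 0 <= \tr (N *m M').
  by rewrite tr_mul_sum_outer sumr_ge0 // => x _; rewrite mulr_ge0 //; case: psdN.
have n0' : 0 < n%:R :> R by rewrite ltr0n.
have le2 : \det N * \det M' <= 1.
  apply: (le_trans le1); rewrite exprn_ile1 ?divr_ge0 ?ler0n //.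
  by rewrite ler_pdivrMr // mul1r.
have /andP[dM0 _] := (hadamard_psd (conj symM posM)).2.
rewrite -[leLHS]mul1r -detN -mulrA -[leRHS]mulr1.
by rewrite ler_wpM2l.
Qed.
End Sufficiency.

(** * The optimal weight *)

Section OptimalWeight.
Variable R : rcfType.
Implicit Types k l u p : R.

(** The first-order optimality condition on the weight [p] of the orbit [l] in a
mixture of the orbits [l] and [u]: the derivative of [log det M] vanishes, where
[det M] is proportional to [D^(k - 1) p (1 - p)] with
[D = p l (k - l) + (1 - p) u (k - u)].  Denominators are cleared. *)
Definition stationary k l u p : Prop :=
  (k - 1) * ((u - l) * (l + u - k)) * (p * (1 - p))
  + (1 - 2 * p) * (p * (l * (k - l)) + (1 - p) * (u * (k - u))) = 0.

Lemma quadratic_root_stationary k l u : 0 <= l -> l < u -> u <= k -> 0 < k ->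
  let e := (u - l) * (l + u - k) in
  e != 0 ->
  let p := (e * k - 2 * u * (k - u)
            + Num.sqrt (e ^+ 2 * k ^+ 2 + 4 * l * (k - l) * u * (k - u)))
           / (2 * e * (k + 1)) in
  0 < p < 1 /\ stationary k l u p.
Proof.
move=> l0 lu uk k0 e e0.
set A := l * (k - l); set B := u * (k - u).
have eqe : e = A - B by rewrite /e /A /B; ring.
have A0 : 0 <= A by rewrite mulr_ge0 //; lra.
have B0 : 0 <= B by rewrite mulr_ge0 //; lra.
have -> : 4 * l * (k - l) * u * (k - u) = 4 * (A * B) by rewrite /A /B; ring.
have -> : 2 * u * (k - u) = 2 * B by rewrite /B; ring.
set S := Num.sqrt _.
have S0 : 0 <= S by apply: sqrtr_ge0.
have S2 : S ^+ 2 = e ^+ 2 * k ^+ 2 + 4 * (A * B).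
  by apply: sqr_sqrtr; rewrite -exprMn addr_ge0 ?sqr_ge0 // mulr_ge0 // mulr_ge0.
rewrite /stationary -/e -/A -/B.
set p := _ / (2 * e * (k + 1)).
have k1 : k + 1 != 0 by apply/eqP; lra.
have eqp : 2 * (e * (k + 1)) * p = e * k - 2 * B + S.
  by rewrite /p; field; rewrite e0 k1.
clearbody p S; clear l0 lu uk; clearbody e A B; subst e.
set e := A - B in e0 eqp S2 *.
have lt_root x : x < 0 \/ x ^+ 2 < S ^+ 2 -> x < S by nra.
have root_lt x : 0 <= x -> S ^+ 2 < x ^+ 2 -> S < x by nra.
have ek0 : e * (k + 1) != 0 by rewrite mulf_neq0.
split; last first.
  apply: (mulfI ek0); rewrite mulr0.
  have -> : e * (k + 1) * ((k - 1) * e * (p * (1 - p)) +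
      (1 - 2 * p) * (p * A + (1 - p) * B)) =
    ((e * k - 2 * B) ^+ 2 + 4 * (k + 1) * e * B
      - (2 * (e * (k + 1)) * p - (e * k - 2 * B)) ^+ 2) / 4.
    by rewrite /e; field.
  rewrite eqp [_ + S - _]addrC addKr S2.
  by rewrite /e; field.
(* The bounds on [p] are bounds on [S] by expressions linear in [e] and [A] or [B];
   each is proved by comparing squares. *)
have [e_gt0|e_lt0|/eqP] := ltgtP 0 e; last by rewrite eq_sym (negbTE e0).
- have ek : 0 < e * k by rewrite mulr_gt0.
  have X0 : 2 * B - e * k < S.
    apply: lt_root; have [B_gt0|] := ltP 0 B; last by left; lra.
    right; rewrite -subr_gt0 S2.
    have -> : e ^+ 2 * k ^+ 2 + 4 * (A * B) - (2 * B - e * k) ^+ 2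
      = 4 * (k + 1) * e * B by rewrite /e; ring.
    by rewrite !mulr_gt0 //; lra.
  have X1 : S < (k + 2) * e + 2 * B.
    apply: root_lt; first by nra.
    rewrite -subr_gt0 S2.
    have -> : ((k + 2) * e + 2 * B) ^+ 2 - (e ^+ 2 * k ^+ 2 + 4 * (A * B))
      = 4 * (k + 1) * e * (e + B) by rewrite /e; ring.
    by rewrite !mulr_gt0 //; lra.
  have ep : 0 < 2 * (e * (k + 1)) by rewrite !mulr_gt0 //; lra.
  apply/andP; split; first by rewrite -(pmulr_rgt0 _ ep) eqp; lra.
  rewrite -(ltr_pM2l ep) eqp mulr1; lra.
- have ek : e * k < 0 by rewrite nmulr_rlt0.
  have X0 : S < 2 * B - e * k.
    apply: root_lt; first by nra.
    rewrite -subr_gt0 S2.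
    have -> : (2 * B - e * k) ^+ 2 - (e ^+ 2 * k ^+ 2 + 4 * (A * B))
      = 4 * (k + 1) * - e * B by rewrite /e; ring.
    by rewrite !mulr_gt0 //; move: e_lt0; rewrite /e; lra.
  have X1 : e * k + 2 * A < S.
    apply: lt_root; have [A_gt0|] := ltP 0 A; last by left; lra.
    right; rewrite -subr_gt0 S2.
    have -> : e ^+ 2 * k ^+ 2 + 4 * (A * B) - (e * k + 2 * A) ^+ 2
      = 4 * (k + 1) * - e * A by rewrite /e; ring.
    by rewrite !mulr_gt0 //; lra.
  have ep : 2 * (e * (k + 1)) < 0 by nra.
  apply/andP; split; first by rewrite -(nmulr_rlt0 _ ep) eqp; lra.
  by rewrite -(ltr_nM2l ep) eqp mulr1; move: X1; rewrite /e; lra.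
Qed.

Lemma half_stationary k l u : l + u = k -> stationary k l u (1 / 2).
Proof. by move=> <-; rewrite /stationary; field. Qed.

(** Under the condition on the orbits, the variance function of the stationary
mixture is convex in the depth (second conclusion).  The third conclusion says
that this function takes the value [k + 1] on the orbit [l]. *)
Lemma stationary_convex k l u p :
    0 <= l -> l < u -> u <= k -> 1 < k -> 0 < p < 1 ->
    stationary k l u p ->
    (k - 2 * l) * (2 * u - k) < k ->
  let D := p * (l * (k - l)) + (1 - p) * (u * (k - u)) in
  [/\ 0 < D, (k - 1) * (p * (1 - p) * (u - l) ^+ 2) <= D
  & p * ((k + 1) * D - (k - 1) * (l * (k - l))) = D ].
Proof.
move=> l0 lu uk k1 /andP[p0 p1] st cond D.
set A := l * (k - l); set B := u * (k - u).
have A0 : 0 <= A by rewrite mulr_ge0 //; lra.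
have B0 : 0 <= B by rewrite mulr_ge0 //; lra.
have q0 : 0 < 1 - p by lra.
(* [D] could only vanish for [l = 0] and [u = k], which the condition excludes. *)
have D0 : 0 < D.
  have := mulr_ge0 (ltW p0) A0; have := mulr_ge0 (ltW q0) B0 => h1 h2.
  have [//|le0] := ltP 0 D.
  have pA : p * A = 0 by move: le0; rewrite /D -/A -/B; lra.
  have qB : (1 - p) * B = 0 by move: le0; rewrite /D -/A -/B; lra.
  have Az : A = 0 by move/eqP: pA; rewrite mulf_eq0 gt_eqF //= => /eqP.
  have Bz : B = 0 by move/eqP: qB; rewrite mulf_eq0 gt_eqF //= => /eqP.
  have l00 : l = 0.
    by move/eqP: Az; rewrite mulf_eq0 => /orP[/eqP//|/eqP]; lra.
  have uk0 : u = k by move/eqP: Bz; rewrite mulf_eq0 => /orP[]/eqP; lra.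
  by move: cond; rewrite l00 uk0; nra.
(* [P1] and [P2] are [D / p] and [D / (1 - p)]: the variance function equals
   [k + 1] on both orbits. *)
set P1 := (k + 1) * D - (k - 1) * A.
set P2 := (k + 1) * D - (k - 1) * B.
have eq1 : p * P1 = D.
  by apply/esym/eqP; rewrite -subr_eq0 -[X in _ == X]st /P1 /D /A /B; apply/eqP; ring.
have eq2 : (1 - p) * P2 = D.
  have -> : (1 - p) * P2 = 2 * D - p * P1 by rewrite /P1 /P2 /D /A /B; ring.
  by rewrite eq1; ring.
split => //.
have P1_gt0 : 0 < P1 by rewrite -(pmulr_rgt0 _ p0) eq1.
have P2_gt0 : 0 < P2 by rewrite -(pmulr_rgt0 _ q0) eq2.
(* As [1 / (p (1 - p)) = 1 / p + 1 / (1 - p)], the claim amounts to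
   [(k - 1) (u - l)^2 <= P1 + P2], which is [main]. *)
pose Q := (k * (l + u) - 2 * (u * l)) / 2.
have main : (k - 1) * Q <= (k + 1) * D.
  (* Otherwise [p] and [1 - p] are so large, by [h1] and [h2], that their sum exceeds
     [1]. *)
  rewrite leNgt; apply/negP => lt.
  have Qpos : 0 < Q.
    have : 0 < (k - 1) * Q by apply: lt_trans lt; rewrite mulr_gt0 //; lra.
    by rewrite pmulr_rgt0 //; lra.
  have h1 : Q <= p * (k + 1) * ((k - 2 * l) * (u - l) / 2).
    rewrite -(ler_pM2r D0).
    have -> : p * (k + 1) * ((k - 2 * l) * (u - l) / 2) * D
      = p * ((k + 1) * (Q - A) * D) by rewrite /Q /A; field.
    rewrite -{1}eq1 mulrCA ler_pM2l //.
    rewrite -subr_ge0.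
    have -> : (k + 1) * (Q - A) * D - Q * P1 = A * ((k - 1) * Q - (k + 1) * D).
      by rewrite /P1; ring.
    by rewrite mulr_ge0 //; lra.
  have h2 : Q <= (1 - p) * (k + 1) * ((2 * u - k) * (u - l) / 2).
    rewrite -(ler_pM2r D0).
    have -> : (1 - p) * (k + 1) * ((2 * u - k) * (u - l) / 2) * D
      = (1 - p) * ((k + 1) * (Q - B) * D) by rewrite /Q /B; field.
    rewrite -{1}eq2 mulrCA ler_pM2l //.
    rewrite -subr_ge0.
    have -> : (k + 1) * (Q - B) * D - Q * P2 = B * ((k - 1) * Q - (k + 1) * D).
      by rewrite /P2; ring.
    by rewrite mulr_ge0 //; lra.
  have a0 : 0 < k - 2 * l.
    have : 0 < p * (k + 1) * ((k - 2 * l) * (u - l) / 2) by apply: lt_le_trans h1.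
    rewrite pmulr_rgt0; last by rewrite mulr_gt0 //; lra.
    by rewrite -mulrA pmulr_lgt0 //; lra.
  have b0 : 0 < 2 * u - k.
    have : 0 < (1 - p) * (k + 1) * ((2 * u - k) * (u - l) / 2) by apply: lt_le_trans h2.
    rewrite pmulr_rgt0; last by rewrite mulr_gt0 //; lra.
    by rewrite -mulrA pmulr_lgt0 //; lra.
  have h1' := ler_wpM2r (ltW b0) h1.
  have h2' := ler_wpM2r (ltW a0) h2.
  have h3 : Q * (2 * (u - l)) <= (k + 1) * ((k - 2 * l) * (2 * u - k) / 4) * (2 * (u - l)).
    by apply: le_trans (_ : Q * (2 * u - k) + Q * (k - 2 * l) <= _); lra.
  have ul : 0 < 2 * (u - l) by lra.
  move: h3; rewrite ler_pM2r //.
  have -> : Q = (k ^+ 2 + (k - 2 * l) * (2 * u - k)) / 4 by rewrite /Q; field.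
  by have := cond; nra.
rewrite -(ler_pM2r P1_gt0) -(ler_pM2r P2_gt0).
have -> : (k - 1) * (p * (1 - p) * (u - l) ^+ 2) * P1 * P2
  = (k - 1) * (u - l) ^+ 2 * (p * P1) * ((1 - p) * P2) by ring.
have -> : D * P1 * P2 = D * D * (P1 + P2).
  have h : (1 - p) * P2 * P1 + p * P1 * P2 = D * (P1 + P2).
    by rewrite eq1 eq2; ring.
  by rewrite -[D * D * _]mulrA -h; ring.
rewrite eq1 eq2.
have -> : (k - 1) * (u - l) ^+ 2 * D * D = D * D * ((k - 1) * (u - l) ^+ 2).
  by ring.
rewrite ler_pM2l ?mulr_gt0 //.
rewrite -subr_ge0.
have -> : P1 + P2 - (k - 1) * (u - l) ^+ 2 = 2 * ((k + 1) * D - (k - 1) * Q).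
  by rewrite /P1 /P2 /Q /A /B; field.
by rewrite mulr_ge0 //; lra.
Qed.
End OptimalWeight.

(** The variance function of the stationary mixture, as a function of the depth [d],
is at most [k + 1] between the two orbits. *)
Lemma variance_le (R : rcfType) (k l u p d : R) :
    0 <= l -> l < u -> u <= k -> 1 < k -> 0 < p < 1 ->
    stationary k l u p -> (k - 2 * l) * (2 * u - k) < k ->
    l <= d <= u ->
  1 + (d - (p * l + (1 - p) * u)) ^+ 2 / (p * (1 - p) * (u - l) ^+ 2)
    + (k - 1) * (d * (k - d)) / (p * (l * (k - l)) + (1 - p) * (u * (k - u)))
  <= k + 1.
Proof.
move=> l0 lu uk k1 p01 st cond /andP[ld du].
have [] := stationary_convex l0 lu uk k1 p01 st cond.
set D := p * _ + _ => D0 convex eqp.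
set V := p * (1 - p) * (u - l) ^+ 2 in convex *.
case/andP: p01 => p0 p1.
have q0 : 0 < 1 - p by lra.
have ul : 0 < u - l by lra.
have V0 : 0 < V by rewrite !mulr_gt0.
rewrite -subr_le0 -(pmulr_lle0 _ (mulr_gt0 V0 D0)).
set X := (X in X <= 0).
(* The second summand vanishes by stationarity ([eqp]). *)
have -> : X = (D - (k - 1) * V) * ((d - l) * (d - u))
  + (p * ((k + 1) * D - (k - 1) * (l * (k - l))) - D)
    * ((u - l) * ((d - l) * p - (u - d) * (1 - p))).
  have nz : [&& p != 0, 1 - p != 0, u - l != 0 & D != 0] by rewrite !gt_eqF.
  case/and4P: nz => p0' q0' ul0 D0'.
  have D2 : D = p * (l * (k - l)) + (1 - p) * (u * (k - u)) by [].
  rewrite /X /V; move: D D2 D0' {D0 convex eqp X V V0} => D D2 D0'.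
  rewrite [X in X * _](_ : _ = ((d - (p * l + (1 - p) * u)) ^+ 2 * D
    + p * (1 - p) * (u - l) ^+ 2 * ((k - 1) * (d * (k - d)) - k * D))
    / (p * (1 - p) * (u - l) ^+ 2 * D)); last by field; rewrite ?p0' ?q0' ?ul0 ?D0'.
  rewrite divfK; last by rewrite !mulf_neq0 // expf_neq0.
  by rewrite D2; ring.
rewrite eqp subrr mul0r addr0.
by rewrite mulr_ge0_le0 ?subr_ge0 // mulr_ge0_le0 ?subr_ge0 ?subr_le0.
Qed.

Lemma wL_opt_stationary (R : realType) (K L U : nat) :
    (L < U)%N -> (U <= K)%N ->
  0 < wL_opt R K L U < 1 /\ stationary K%:R L%:R U%:R (wL_opt R K L U).
Proof.
move=> LU UK; rewrite /wL_opt.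
case: eqVneq => [eqK | neqK].
  split; first by apply/andP; split; lra.
  by apply: half_stationary; rewrite -natrD eqK.
have lu : L%:R < U%:R :> R by rewrite ltr_nat.
have e0 : (U%:R - L%:R) * (L%:R + U%:R - K%:R) != 0 :> R.
  by apply: mulf_neq0; rewrite subr_eq0; [rewrite gt_eqF | rewrite -natrD eqr_nat].
have k0 : 0 < K%:R :> R by rewrite ltr0n; lia.
have := quadratic_root_stationary (ler0n R L) lu _ k0 e0.
rewrite ler_nat exprMn !mulrA; apply; exact: UK.
Qed.

(** * Moments of the coordinates on an orbit *)

Section OrbitMoments.
Variables (R : realType) (K : nat).
Implicit Types (k : nat) (x : signs K).

Lemma sgval_sqr (b : bool) : sgval R b * sgval R b = 1.
Proof. by case: b; rewrite /sgval ?mulrNN mulr1. Qed.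

Lemma sum_sgval x : \sum_j sgval R (x j) = 2 * (depth x)%:R - K%:R.
Proof. by rewrite (depthE R x); field. Qed.

(** The mean of [g] over the points of depth [k]. *)
Definition orbit_mean k (g : signs K -> R) : R :=
  'C(K, k)%:R^-1 * \sum_(x : signs K | depth x == k) g x.

Lemma card_orbit k : #|[pred x : signs K | depth x == k]| = 'C(K, k).
Proof.
pose f (A : {set 'I_K}) : signs K := [ffun j => j \in A].
have fI : injective f.
  by move=> A B /ffunP eqf; apply/setP=> j; have := eqf j; rewrite !ffunE.
rewrite -[in RHS](card_ord K) -card_draws -(card_imset _ fI).
apply: eq_card => x; rewrite inE; apply/idP/imsetP => [dx | [A + ->]].
  exists [set j | x j]; first by rewrite inE.
  by apply/ffunP => j; rewrite ffunE inE.
by rewrite inE /depth; congr (_ == _); apply: eq_card => j; rewrite !inE ffunE.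
Qed.

Lemma sum_orbit_design L U k (g : signs K -> R) : (L <= k <= U)%N ->
  \sum_(x : region K L U) orbit_design R k x * g (val x) = orbit_mean k g.
Proof.
move=> /andP[Lk kU].
rewrite -(big_sub [pred x : signs K | L <= depth x <= U]%N (fun x =>
  (if depth x == k then 'C(K, k)%:R^-1 else 0) * g x)) /=.
rewrite /orbit_mean mulr_sumr [RHS]big_mkcond [LHS]big_mkcond /=.
apply: eq_bigr => x _; rewrite inE.
have [->|_] := eqVneq (depth x) k; first by rewrite Lk kU.
by rewrite mul0r; case: ifP.
Qed.

Lemma orbit_mean_cst k (c : R) : (k <= K)%N -> orbit_mean k (fun=> c) = c.
Proof.
move=> kK; rewrite /orbit_mean sumr_const -[c *+ _]mulr_natl.
by rewrite card_orbit mulKf // pnatr_eq0 -lt0n bin_gt0.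
Qed.

Lemma orbit_mean_sum k (I : finType) (g : I -> signs K -> R) :
  orbit_mean k (fun x => \sum_i g i x) = \sum_i orbit_mean k (g i).
Proof. by rewrite /orbit_mean exchange_big mulr_sumr. Qed.

Lemma orbit_mean_mulr k c (g : signs K -> R) :
  orbit_mean k (fun x => c * g x) = c * orbit_mean k g.
Proof. by rewrite /orbit_mean -mulr_sumr mulrCA. Qed.

Lemma eq_orbit_mean k (g h : signs K -> R) :
  (forall x, depth x = k -> g x = h x) -> orbit_mean k g = orbit_mean k h.
Proof.
by move=> eqgh; congr (_ * _); apply: eq_bigr => x /eqP; apply: eqgh.
Qed.

Lemma orbit_mean_perm k (g : signs K -> R) (s : 'S_K) :
  orbit_mean k (fun x => g [ffun j => x (s j)]) = orbit_mean k g.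
Proof.
congr (_ * _).
pose h x : signs K := [ffun j => x (s j)].
have hI : injective h.
  move=> x y /ffunP eqh; apply/ffunP => j.
  by have := eqh ((s^-1)%g j); rewrite !ffunE permKV.
rewrite [RHS](reindex_inj hI) /=; apply: eq_bigl => x; congr (_ == _).
rewrite /depth -[RHS](card_imset _ (@perm_inj _ s)); apply: eq_card => j.
rewrite inE; apply/idP/imsetP => [xj | [i + ->]]; last by rewrite inE ffunE.
by exists ((s^-1)%g j); rewrite ?inE ?ffunE permKV.
Qed.

(** By symmetry all coordinates have the same mean, and their sum is constant on the
orbit. *)
Lemma orbit_mean_coord k i : (0 < K)%N -> (k <= K)%N ->
  orbit_mean k (fun x => sgval R (x i)) = (2 * k%:R - K%:R) / K%:R.
Proof.
move=> K0 kK.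
have same j : orbit_mean k (fun x => sgval R (x j)) =
              orbit_mean k (fun x => sgval R (x i)).
  rewrite -(orbit_mean_perm k _ (tperm i j)).
  by apply: eq_orbit_mean => x _; rewrite ffunE tpermR.
have nzK : K%:R != 0 :> R by rewrite pnatr_eq0 -lt0n.
apply: (mulIf nzK); rewrite divfK //.
transitivity (\sum_j orbit_mean k (fun x => sgval R (x j))).
  by rewrite (eq_bigr _ (fun j _ => same j)) sumr_const card_ord mulr_natr.
rewrite -orbit_mean_sum -[RHS](orbit_mean_cst _ kK).
by apply: eq_orbit_mean => x <-; rewrite sum_sgval.
Qed.

(** The same symmetry argument, applied to the products of the [i]-th coordinate with
the others. *)
Lemma orbit_mean_coord2 k i j : (1 < K)%N -> (k <= K)%N -> i != j ->
  orbit_mean k (fun x => sgval R (x i) * sgval R (x j))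
  = ((2 * k%:R - K%:R) ^+ 2 - K%:R) / (K%:R * (K%:R - 1)).
Proof.
move=> K1 kK neq.
have K0 : (0 < K)%N by apply: ltnW.
pose c j' := orbit_mean k (fun x => sgval R (x i) * sgval R (x j')).
have same j' : j' != i -> c j' = c j.
  move=> neq'; rewrite /c -(orbit_mean_perm k _ (tperm j j')).
  apply: eq_orbit_mean => x _; rewrite !ffunE tpermR tpermD // eq_sym //.
have cii : c i = 1.
  rewrite -[RHS](orbit_mean_cst 1 kK).
  by apply: eq_orbit_mean => x _; rewrite sgval_sqr.
have sumc : \sum_j' c j' = (2 * k%:R - K%:R) ^+ 2 / K%:R.
  rewrite -orbit_mean_sum.
  transitivity (orbit_mean k (fun x => (2 * k%:R - K%:R) * sgval R (x i))).
    by apply: eq_orbit_mean => x <-; rewrite -mulr_sumr sum_sgval mulrC.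
  by rewrite orbit_mean_mulr orbit_mean_coord // expr2 mulrA.
move: sumc; rewrite (bigD1 i) //= cii (eq_bigr (fun=> c j)) => [|j' /same //].
rewrite sumr_const cardC1 card_ord -[c j *+ _]mulr_natr -subn1 natrB // -/(c j).
have nzK : K%:R != 0 :> R by rewrite pnatr_eq0 -lt0n.
have nzK1 : K%:R - 1 != 0 :> R by rewrite subr_eq0 pnatr_eq1 gtn_eqF.
move=> eqc; apply: (mulIf nzK1).
have -> : c j * (K%:R - 1) = (2 * k%:R - K%:R) ^+ 2 / K%:R - 1.
  by rewrite -eqc; ring.
by field; rewrite nzK nzK1.
Qed.
End OrbitMoments.

(** * Permutation-invariant block matrices *)

Section MomentMatrix.
Variables (R : rcfType) (K : nat).
Local Notation o := (const_mx 1 : 'cV[R]_K).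

(** The general symmetric matrix of size [1 + K] invariant under permutations of the
last [K] indices: [a] in the corner, [b] along the first row and column, and
[c I + d J] in the remaining block, with [J] the all-ones matrix. *)
Definition sym_block_mx (a b c d : R) : 'M[R]_(1 + K) :=
  block_mx a%:M (b *: o^T) (b *: o) (c%:M + d *: (o *m o^T)).

Lemma mul_sym_block_mx a b c d a' b' c' d' :
  sym_block_mx a b c d *m sym_block_mx a' b' c' d'
  = block_mx (a * a' + b * b' * K%:R)%:M
      ((a * b' + b * c' + b * d' * K%:R) *: o^T)
      ((b * a' + c * b' + d * b' * K%:R) *: o)
      ((c * c')%:M + (b * b' + c * d' + d * c' + d * d' * K%:R) *: (o *m o^T)).
Proof.
have oo : o^T *m o = K%:R%:M.
  apply/matrixP=> i j; rewrite !ord1 !mxE eqxx (eq_bigr (fun=> 1)) => [|l _].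
    by rewrite sumr_const card_ord.
  by rewrite !mxE mulr1.
rewrite /sym_block_mx mulmx_block; congr block_mx.
- by rewrite -scalar_mxM -scalemxAl -scalemxAr oo !scale_scalar_mx mulrA [RHS]raddfD /=.
- rewrite mul_scalar_mx scalerA mulmxDr mul_mx_scalar scalerA -scalemxAl -scalemxAr.
  by rewrite mulmxA oo mul_scalar_mx !scalerA -!scalerDl; congr (_ *: _); ring.
- rewrite mul_mx_scalar scalerA mulmxDl mul_scalar_mx scalerA -scalemxAl -scalemxAr.
  by rewrite -mulmxA oo mul_mx_scalar !scalerA -!scalerDl; congr (_ *: _); ring.
rewrite mulmxDl !mulmxDr -scalar_mxM mul_scalar_mx mul_mx_scalar.
rewrite -!scalemxAl -!scalemxAr !mulmxA -[o *m o^T *m o]mulmxA oo mul_mx_scalar.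
rewrite -!scalemxAl !scalerA -!addrA [LHS]addrCA; congr (_ + _).
by rewrite -!scalerDl; congr (_ *: _); ring.
Qed.

Lemma qform_sym_block_mx a b c d (y : 'cV[R]_K) :
  qform (sym_block_mx a b c d) (col_mx 1%:M y)
  = a + 2 * b * (\sum_j y j 0) + c * (\sum_j y j 0 ^+ 2) + d * (\sum_j y j 0) ^+ 2.
Proof.
have -> : sym_block_mx a b c d = block_mx a%:M (b *: o)^T (b *: o) (c%:M + d *: (o *m o^T)).
  by rewrite /sym_block_mx linearZ.
have oy : (o^T *m y) 0 0 = \sum_j y j 0.
  by rewrite mxE; apply: eq_bigr => j _; rewrite !mxE mul1r.
have yo : (y^T *m o) 0 0 = \sum_j y j 0.
  by rewrite mxE; apply: eq_bigr => j _; rewrite !mxE mulr1.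
have yy : (y^T *m y) 0 0 = \sum_j y j 0 ^+ 2.
  by rewrite mxE; apply: eq_bigr => j _; rewrite !mxE expr2.
rewrite qform_block.
have -> : ((b *: o)^T *m y) 0 0 = b * (o^T *m y) 0 0.
  by rewrite linearZ /= -scalemxAl [LHS]mxE.
have -> : qform (c%:M + d *: (o *m o^T)) y
  = c * (y^T *m y) 0 0 + d * ((y^T *m o) 0 0 * (o^T *m y) 0 0).
  rewrite /qform mulmxDr mulmxDl mul_mx_scalar -scalemxAr -!scalemxAl mulmxA.
  rewrite -[_ *m o^T *m y]mulmxA mxE [X in X + _]mxE [X in _ + X]mxE.
  by rewrite [(_ *m (_ *m _)) _ _]mxE big_ord1.
by rewrite oy yo yy; ring.
Qed.
End MomentMatrix.

(** The inverse of the moment matrix of a random permutation-invariant sign vector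
whose coordinate sum has mean [mu] and variance [V]. *)
Lemma moment_matrix_inverse (R : rcfType) (K : nat) (mu V : R) :
  let k : R := K%:R in let E := k ^+ 2 - (V + mu ^+ 2) in
  let r := (V + mu ^+ 2 - k) / (k * (k - 1)) in let t := (k - 1) / E in
  (1 < K)%N -> V != 0 -> E != 0 ->
  sym_block_mx K 1 (mu / k) (1 - r) r
  *m sym_block_mx K (1 + mu ^+ 2 / V) (- (mu / V)) (t * k) (V^-1 - t) = 1%:M.
Proof.
move=> k E r t K1 V0 E0.
have k0 : k != 0 by rewrite pnatr_eq0 -lt0n ltnW.
have k10 : k - 1 != 0 by rewrite subr_eq0 pnatr_eq1 gtn_eqF.
rewrite mul_sym_block_mx -/k [RHS]scalar_mx_block.
congr block_mx.
- by congr _%:M; field; rewrite ?k0 ?V0.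
- rewrite [X in X *: _](_ : _ = 0) ?scale0r //.
  by rewrite /t /E; field; rewrite ?k0 ?V0 ?k10 ?E0.
- rewrite [X in X *: _](_ : _ = 0) ?scale0r //.
  by rewrite /r; field; rewrite ?k0 ?V0 ?k10 ?E0.
- rewrite [X in _ + X *: _](_ : _ = 0) ?scale0r ?addr0; first congr _%:M.
  + by rewrite /r /t /E; field; rewrite ?k0 ?V0 ?k10 ?E0.
  + by rewrite /r /t /E; field; rewrite ?k0 ?V0 ?k10 ?E0.
Qed.

(** * Mixtures of two orbits *)

Lemma qform_regression (R : realType) (K : nat) (a b c d : R) (x : signs K) :
  let s := 2 * (depth x)%:R - K%:R in
  qform (sym_block_mx K a b c d) (regression R x)
  = a + 2 * b * s + c * K%:R + d * s ^+ 2.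
Proof.
move=> s; rewrite /regression qform_sym_block_mx.
have -> : \sum_j (\col_(j < K) sgval R (x j)) j 0 = s.
  by rewrite /s -sum_sgval; apply: eq_bigr => j _; rewrite mxE.
rewrite [X in _ + c * X](_ : _ = K%:R) // -[K in RHS]card_ord -sumr_const.
by apply: eq_bigr => j _; rewrite mxE expr2 sgval_sqr.
Qed.

Section TwoOrbitDesign.
Variables (R : realType) (K L U : nat) (p : R).
Hypotheses (LU : (L <= U)%N) (UK : (U <= K)%N).

(** The invariant design with weight [p] on the orbit [L] and [1 - p] on the orbit
[U]. *)
Definition two_orbit_design (x : region K L U) : R :=
  p * orbit_design R L x + (1 - p) * orbit_design R U x.

Lemma sum_two_orbit_design (g : signs K -> R) :
  \sum_x two_orbit_design x * g (val x)
  = p * orbit_mean L g + (1 - p) * orbit_mean U g.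
Proof.
rewrite -(@sum_orbit_design R K L U L) ?leqnn //.
rewrite -(@sum_orbit_design R K L U U) ?LU ?leqnn //.
rewrite !mulr_sumr -big_split /=; apply: eq_bigr => x _.
by rewrite mulrDl !mulrA.
Qed.

Lemma is_design_two_orbit : 0 <= p <= 1 -> is_design two_orbit_design.
Proof.
move=> /andP[p0 p1]; split=> [x|].
  have orb_ge0 k : 0 <= orbit_design R k x.
    by rewrite /orbit_design; case: ifP; rewrite // invr_ge0 ler0n.
  by rewrite addr_ge0 ?mulr_ge0 ?subr_ge0.
transitivity (\sum_x two_orbit_design x * 1).
  by apply: eq_bigr => x _; rewrite mulr1.
rewrite (sum_two_orbit_design (fun=> 1)) !orbit_mean_cst ?(leq_trans LU) //.
by rewrite !mulr1 addrC subrK.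
Qed.

Lemma info_matrix_two_orbit : (1 < K)%N ->
  let k : R := K%:R in let a := 2 * L%:R - k in let b := 2 * U%:R - k in
  let r := (p * a ^+ 2 + (1 - p) * b ^+ 2 - k) / (k * (k - 1)) in
  info_matrix two_orbit_design
  = sym_block_mx K 1 ((p * a + (1 - p) * b) / k) (1 - r) r.
Proof.
move=> K1 k a b r.
have LK : (L <= K)%N by apply: leq_trans UK.
have K0 : (0 < K)%N by apply: ltnW.
have k0 : k != 0 by rewrite pnatr_eq0 -lt0n.
have k10 : k - 1 != 0 by rewrite subr_eq0 pnatr_eq1 gtn_eqF.
have entry i j : info_matrix two_orbit_design i j =
  p * orbit_mean L (fun x => regression R x i 0 * regression R x j 0)
  + (1 - p) * orbit_mean U (fun x => regression R x i 0 * regression R x j 0).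
  rewrite -sum_two_orbit_design summxE; apply: eq_bigr => x _.
  by rewrite !mxE big_ord1 !mxE.
have f0 x i : regression R x (lshift K i) 0 = 1.
  by rewrite /regression col_mxEu ord1 mxE eqxx.
have f1 x i : regression R x (rshift 1 i) 0 = sgval R (x i).
  by rewrite /regression col_mxEd mxE.
apply/matrixP=> i j; rewrite entry /sym_block_mx.
case: (split_ordP i) => i' ->; case: (split_ordP j) => j' ->.
- rewrite block_mxEul !ord1 !mxE eqxx.
  rewrite !(eq_orbit_mean (h := fun=> 1)) => [|x _|x _]; rewrite ?f0 ?mulr1 //.
  by rewrite !orbit_mean_cst // !mulr1 addrC subrK.
- rewrite block_mxEur !mxE mulr1.
  rewrite !(eq_orbit_mean (h := fun x => sgval R (x j'))) => [|x _|x _];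
    rewrite ?f0 ?f1 ?mul1r //.
  by rewrite !orbit_mean_coord // -/k -/a -/b; field.
- rewrite block_mxEdl !mxE mulr1.
  rewrite !(eq_orbit_mean (h := fun x => sgval R (x i'))) => [|x _|x _];
    rewrite ?f0 ?f1 ?mulr1 //.
  by rewrite !orbit_mean_coord // -/k -/a -/b; field.
rewrite block_mxEdr !mxE big_ord1 !mxE !mulr1.
rewrite !(eq_orbit_mean (h := fun x => sgval R (x i') * sgval R (x j'))) => [|x _|x _];
  rewrite ?f1 //.
have [<-|neq] := eqVneq i' j'.
  rewrite !(eq_orbit_mean (h := fun=> 1)) => [|x _|x _]; rewrite ?sgval_sqr //.
  by rewrite !orbit_mean_cst // mulr1n subrK !mulr1 addrC subrK.
rewrite !orbit_mean_coord2 // mulr0n add0r -/k -/a -/b /r.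
by field; rewrite k0 k10.
Qed.
End TwoOrbitDesign.

Theorem theorem1 (R : realType) (K L U : nat)
    (hK : (1 <= K)%N) (hLU : (L < U)%N) (hUK : (U <= K)%N)
    (hcond : (K%:Z - 2 * L%:Z) * (2 * U%:Z - K%:Z) < K%:Z) :
  D_optimal (invariant_design (L := L) (U := U) (K := K) (opt_weight R K L U)).
Proof.
(* For [K = 1] the condition reads [1 < 1]. *)
have K1 : (1 < K)%N.
  by rewrite ltnNge; apply/negP => K1; move: hcond;
    have [-> [-> ->]] : K = 1%N /\ L = 0%N /\ U = 1%N by lia.
have [p01 st] := wL_opt_stationary R hLU hUK.
set p := wL_opt R K L U in p01 st.
have eqdes (x : region K L U) : invariant_design (opt_weight R K L U) x = two_orbit_design p x.
  by rewrite invariant_design_opt_weight.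
have [ge0 sum1] : is_design (@two_orbit_design R K L U p).
  by apply: is_design_two_orbit => //; [apply: ltnW | case/andP: p01 => *; rewrite !ltW].
have eqinfo : info_matrix (invariant_design (opt_weight R K L U) (L := L) (U := U))
    = info_matrix (@two_orbit_design R K L U p).
  by apply: eq_bigr => x _; rewrite eqdes.
split.
  split=> [x|]; first by rewrite eqdes.
  by rewrite -sum1; apply: eq_bigr => x _; rewrite eqdes.
move=> xi [xi_ge0 xi_sum]; rewrite eqinfo.
have l0 : 0 <= L%:R :> R by [].
have lu : L%:R < U%:R :> R by rewrite ltr_nat.
have uk : U%:R <= K%:R :> R by rewrite ler_nat.
have k1 : 1 < K%:R :> R by rewrite ltr1n.
have cond : (K%:R - 2 * L%:R) * (2 * U%:R - K%:R) < K%:R :> R.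
  by move: hcond; rewrite -(ltr_int R) !(rmorphM, rmorphB) /= -!pmulrn.
have [D0 _ _] := stationary_convex l0 lu uk k1 p01 st cond.
have V0 : 0 < p * (1 - p) * (U%:R - L%:R) ^+ 2.
  by case/andP: p01 => p0 p1; rewrite !mulr_gt0 ?subr_gt0.
set k : R := K%:R in uk k1 cond D0 st *.
set l : R := L%:R in l0 lu cond D0 V0 st *.
set u : R := U%:R in lu uk cond D0 V0 st *.
(* Mean and variance of the coordinate sum [2 d - K]. *)
pose mu := p * (2 * l - k) + (1 - p) * (2 * u - k).
pose V := 4 * (p * (1 - p) * (u - l) ^+ 2).
pose E := k ^+ 2 - (V + mu ^+ 2).
have eqE : E = 4 * (p * (l * (k - l)) + (1 - p) * (u * (k - u))).
  by rewrite /E /V /mu; ring.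
have Vn0 : V != 0 by rewrite mulf_neq0 // gt_eqF.
have En0 : E != 0 by rewrite eqE mulf_neq0 // gt_eqF.
have := moment_matrix_inverse K1 Vn0 En0.
have eqT : V + mu ^+ 2 = p * (2 * l - k) ^+ 2 + (1 - p) * (2 * u - k) ^+ 2.
  by rewrite /V /mu; ring.
rewrite {1 2}eqT -(info_matrix_two_orbit _ (ltnW hLU) hUK K1) -/k -/E => inv.
apply: (det_info_le_of_variance_bound _ ge0 xi_ge0 xi_sum inv) => // x.
rewrite qform_regression -/k.
have dle : l <= (depth (val x))%:R <= u by rewrite !ler_nat; exact: valP x.
have := variance_le l0 lu uk k1 p01 st cond dle.
rewrite addnC natrD -/k.
congr (_ <= _).
have -> : mu = 2 * (p * l + (1 - p) * u) - k by rewrite /mu; ring.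
rewrite eqE /V; move: (depth _)%:R (p * l + (1 - p) * u) => d nu.
move: (p * (1 - p) * _) (p * _ + _) V0 D0 => W D W0 D0.
by field; rewrite !gt_eqF.
Qed.
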